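(* Let $\Psi$ be a universal resource. Then $E_{\mathrm{wd}}(\Psi)=\chi_{\mathrm{wd}}(\Psi)=\infty$. Hence any resource on which $E_{\mathrm{wd}}$ or $\chi_{\mathrm{wd}}$ is bounded is not a universal resource.
   Context: For an $N$-qubit $|\psi\rangle$ and an $n$-qubit $|\phi\rangle$, $n\le N$, write $|\psi\rangle\geq_{\mathrm{LOCC}}|\phi\rangle$ if for some set $A$ of $n$ qubits the transformation $|\psi\rangle\to|\phi\rangle^A|0\rangle^{\bar A}$ is achievable exactly and with probability one by LOCC (each qubit a separate party). A resource is an infinite family $\Psi$ of multi-qubit pure states; it is universal if for every $n$ and every $n$-qubit state $|\phi\rangle$ some $|\psi\rangle\in\Psi$ has $|\psi\rangle\geq_{\mathrm{LOCC}}|\phi\rangle$. For a functional $E$, $E(\Psi):=\sup_{|\psi\rangle\in\Psi}E(|\psi\rangle)$. Subcubic tree: tree with all degrees in $\{1,3\}$, leaves = degree-1 vertices. For an $N$-qubit $|\psi\rangle$, take subcubic trees $T$ whose $N$ leaves are the qubits; removing edge $e$ induces a bipartition $(A^e_T,B^e_T)$ of the qubits. With $\rho_A=\mathrm{Tr}_B|\psi\rangle\langle\psi|$, define $E_{\mathrm{wd}}(|\psi\rangle)=\min_T\max_{e\in T}\big(-\mathrm{Tr}\,\rho_{A^e_T}\log_2\rho_{A^e_T}\big)$ (entropic entanglement width) and $\chi_{\mathrm{wd}}(|\psi\rangle)=\min_T\max_{e\in T}\log_2\mathrm{rank}\,\rho_{A^e_T}$ (Schmidt-rank width). *)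

(* Defs.v *)
From HB Require Import structures.
From mathcomp Require Import all_boot all_order all_algebra.
From mathcomp Require Import all_classical all_reals all_analysis.
From mathcomp.real_closed Require Import complex.

Set Implicit Arguments.
Unset Strict Implicit.
Unset Printing Implicit Defensive.

Import Order.TTheory GRing.Theory Num.Theory.
Local Open Scope ring_scope.
Local Open Scope classical_set_scope.

(** Computational basis configurations of N qubits (qubit i in state |x i>). *)
Notation cfg N := {ffun 'I_N -> bool}.

(** An (unnormalized) N-qubit pure state vector in (C^2)^{\otimes N},
    with complex scalars R[i]. *)
Notation qst R N := {ffun {ffun 'I_N -> bool} -> complex R}.

Section QuantumDefs.
Variable R : realType.
Local Notation C := (complex R).
Local Notation qstate N := (qst R N).

Definition sqnorm N (psi : qstate N) : R :=
  \sum_(x : cfg N) complex.Re (psi x * (psi x)^*).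

Definition normalized N (psi : qstate N) : Prop := sqnorm psi = 1.

(** ---------------- LOCC ---------------- *)

(** A local operator on one qubit: a 2x2 complex matrix, [M b c] = <b|M|c>. *)
Definition qop := bool -> bool -> C.

Definition setq N (x : cfg N) (k : 'I_N) (b : bool) : cfg N :=
  [ffun i => if i == k then b else x i].

(** Apply the local operator M on qubit k. *)
Definition apply_local N (k : 'I_N) (M : qop) (psi : qstate N) : qstate N :=
  [ffun x : cfg N => \sum_(c : bool) M (x k) c * psi (setq x k c)].

(** Kraus completeness  sum_m M_m^dagger M_m = I  for a finite-outcome local
    instrument on a single qubit. *)
Definition kraus_complete (m : nat) (ops : 'I_m -> qop) : Prop :=
  forall b b' : bool,
    \sum_(i < m) \sum_(c : bool) ((ops i c b)^* * ops i c b') = (b == b')%:R.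

(** Finite-round LOCC protocols on N parties (one qubit each): a party k
    performs a local instrument with Kraus operators ops, the outcome is
    broadcast, and the rest of the protocol depends on the outcome. *)
Inductive protocol (N : nat) : Type :=
| PStop : protocol N
| PMeasure : forall (k : 'I_N) (m : nat), ('I_m -> qop) -> ('I_m -> protocol N) -> protocol N.

(** [achieves P psi tgt]: every branch of P started on psi ends (exactly) in a
    vector proportional to tgt.  Together with normalisation of psi and tgt this
    is exact, deterministic (probability one) conversion. *)
Fixpoint achieves N (P : protocol N) (psi tgt : qstate N) : Prop :=
  match P with
  | PStop => exists c : C, psi = [ffun x => c * tgt x]
  | PMeasure k m ops next =>
      kraus_complete ops /\
      forall i : 'I_m, achieves (next i) (apply_local k (ops i) psi) tgt
  end.

(** |phi>^A |0>^{\bar A}: the n-qubit phi placed on the qubits f 'I_n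
    (f injective), all remaining qubits in |0>. *)
Definition embed_state n N (f : 'I_n -> 'I_N) (phi : qstate n) : qstate N :=
  [ffun x : cfg N =>
     if [forall i : 'I_N, (i \notin codom f) ==> ~~ x i]
     then phi [ffun j => x (f j)] else 0].

(** psi >=_LOCC phi *)
Definition locc_ge N n (psi : qstate N) (phi : qstate n) : Prop :=
  (n <= N)%N /\
  exists (f : 'I_n -> 'I_N), injective f /\
    exists P : protocol N, achieves P psi (embed_state f phi).

(** A resource: an infinite family of (normalized) multi-qubit pure states. *)
Definition mqstate := {N : nat & qstate N}.

Definition resource (Psi : set mqstate) : Prop :=
  ~ finite_set Psi /\ forall p, Psi p -> normalized (projT2 p).

Definition universal (Psi : set mqstate) : Prop :=
  forall (n : nat) (phi : qstate n), normalized phi ->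
    exists p, Psi p /\ locc_ge (projT2 p) phi.

(** ---------------- reduced density matrices ---------------- *)

(** Configurations supported on A (qubits outside A are 0); these index the
    computational basis of the subsystem A. *)
Definition cfgOn N (A : {set 'I_N}) :=
  {x : cfg N | [forall i : 'I_N, (i \notin A) ==> ~~ x i]}.

Definition glue N (A : {set 'I_N}) (x z : cfg N) : cfg N :=
  [ffun i => if i \in A then x i else z i].

(** rho_A = Tr_{\bar A} |psi><psi|, as a #|cfgOn A| x #|cfgOn A| matrix. *)
Definition rho N (psi : qstate N) (A : {set 'I_N}) : 'M[C]_#|{: cfgOn A}| :=
  \matrix_(i, j)
    \sum_(z : cfgOn (~: A))
      psi (glue A (val (enum_val i)) (val z)) *
      (psi (glue A (val (enum_val j)) (val z)))^*.

Definition log2 (x : R) : R := ln x / ln 2.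

(** -t log2 t, with 0 log 0 = 0. *)
Definition negxlog2x (t : R) : R := if t == 0 then 0 else - (t * log2 t).

(** von Neumann entropy -Tr rho log2 rho = - sum_lambda lambda log2 lambda,
    lambda ranging over the eigenvalues of rho with multiplicity (the roots of
    the characteristic polynomial). *)
Definition vn_entropy n (M : 'M[C]_n) : R :=
  xget 0 [set h : R | exists s : seq C,
     char_poly M = \prod_(z <- s) ('X - z%:P) /\
     h = \sum_(z <- s) negxlog2x (complex.Re z)].

(** ---------------- subcubic trees ---------------- *)

Definition deg (V : finType) (adj : rel V) (v : V) : nat := #|[set w | adj v w]|.

(** A subcubic tree whose leaves are (bijectively) the N qubits. *)
Record sctree (N : nat) := SCTree {
  nv : nat;
  tadj : rel 'I_nv;
  leaf : 'I_N -> 'I_nv;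
  tadj_sym : symmetric tadj;
  tadj_irr : irreflexive tadj;
  tconnected : forall u v, connect tadj u v;
  tacyclic : forall (x : 'I_nv) (p : seq 'I_nv),
      ~~ [&& uniq (x :: p), (2 <= size p)%N, path tadj x p & tadj (last x p) x];
  tdeg : forall v, (deg tadj v == 1)%N || (deg tadj v == 3)%N;
  leaf_deg : forall i, (deg tadj (leaf i) == 1)%N;
  leaf_inj : injective leaf;
  leaf_onto : forall v, (deg tadj v == 1)%N -> exists i, leaf i = v
}.

(** Removing the edge {u,v}: the side A of the bipartition is the set of qubits
    whose leaf is still connected to u. *)
Definition side N (T : sctree N) (u v : 'I_(nv T)) : {set 'I_N} :=
  [set i | connect [rel x y | @tadj N T x y &&
              ~~ (((x == u) && (y == v)) || ((x == v) && (y == u)))]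
                   u (leaf T i)].

(** max over the edges of T of a functional g of the induced bipartition. *)
Definition tree_max N (T : sctree N) (g : {set 'I_N} -> R) : R :=
  \big[Order.max/0]_(e : 'I_(nv T) * 'I_(nv T) | @tadj N T e.1 e.2) g (@side N T e.1 e.2).

(** min over trees of max over edges (for N <= 1 there is no bipartition and
    the width is 0 by convention). *)
Definition width N (g : {set 'I_N} -> R) : \bar R :=
  if (N <= 1)%N then 0%E
  else ereal_inf [set r : \bar R | exists T : sctree N, r = (tree_max T g)%:E].

Definition E_wd N (psi : qstate N) : \bar R :=
  width (fun A => vn_entropy (rho psi A)).

Definition chi_wd N (psi : qstate N) : \bar R :=
  width (fun A => log2 (\rank (rho psi A))%:R).

(** E(Psi) := sup_{psi in Psi} E(psi) *)
Definition sup_res (E : forall N, qstate N -> \bar R) (Psi : set mqstate) : \bar R :=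
  ereal_sup [set E (projT1 p) (projT2 p) | p in Psi].

End QuantumDefs.

(* Main.v *)
Require Import Defs.
From HB Require Import structures.
From mathcomp Require Import all_boot all_order all_algebra.
From mathcomp Require Import spectral sesquilinear.
From mathcomp Require Import all_classical all_reals all_analysis.
From mathcomp.real_closed Require Import complex.
From mathcomp Require Import ring lra zify.
(* [mathcomp.classical.functions] shadows [glue]. *)
Import Defs.

(** The purity [Tr rho_A^2] controls both widths, since
    [- log2 (Tr rho_A^2)] is a lower bound of the von Neumann entropy and of
    [log2 (rank rho_A)].  A local measurement on one side of a cut preserves on
    average the unnormalized reduced state of the other side, so the triangle
    inequality for the Frobenius norm shows that a state convertible into a target
    by LOCC has, across each cut, at most the purity of the target.

    As targets take the cluster states of square grids.  Every subcubic tree has an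
    edge leaving at least a third of the target qubits on each side.  A
    balanced cut of the grid meets many rows, or else it meets every column; taking
    one cut edge in each of these lines, restricted to lines of equal parity, gives a
    large induced matching between the two sides, and the purity of a graph state
    across a cut with an induced matching of size [k] is at most [2^-k]. *)

Set Implicit Arguments.
Unset Strict Implicit.
Unset Printing Implicit Defensive.
Import Order.TTheory GRing.Theory Num.Theory.
Local Open Scope ring_scope.
Local Open Scope sesquilinear_scope.

(** * Balanced edges of subcubic trees *)

(* [deg] counts a classical set, whose membership is [asbool] of the relation. *)
Lemma degE (V : finType) (adj : rel V) v :
  deg adj v = #|[set w | adj v w]%SET|.
Proof. by apply: eq_card => w; rewrite [RHS]inE; apply: boolp.asboolb. Qed.

Section BalancedEdge.
Variables (N : nat) (T : sctree N).
Local Notation adj := (@tadj N T).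
Implicit Types u v a : 'I_(nv T).

(** Adjacency with the edge between [u] and [v] deleted, spelled as in [side] so that membership in
    [side] unfolds to connectivity here. *)
Definition cut_rel u v := [rel x y | adj x y &&
  ~~ (((x == u) && (y == v)) || ((x == v) && (y == u)))].

Lemma cut_rel_sub u v x y : cut_rel u v x y -> adj x y.
Proof. by case/andP. Qed.

Lemma path_avoid_cut u v x p : path adj x p -> v \notin x :: p ->
  path (cut_rel u v) x p.
Proof.
move=> px vNp; apply: (sub_in_path (P := [pred z | z != v]) (e := adj)) px.
  by move=> y z /= /negPf yv /negPf zv yz; rewrite yz yv zv andbF.
by apply/allP => z zp /=; apply: contraNneq vNp => <-.
Qed.

(** A simple path avoiding the edge would close up with it to a cycle; lengths 0 and 1 are excluded
    by irreflexivity and by the deletion itself. *)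
Lemma cut_rel_separates u v : adj u v -> ~~ connect (cut_rel u v) u v.
Proof.
move=> uv; apply/connectP => -[p0 /shortenP[p pp up _] vE].
have adjvu : adj v u by rewrite tadj_sym.
have pa : path adj u p by apply: sub_path pp => x y /cut_rel_sub.
have := tacyclic u p; rewrite up pa -vE adjvu /= andbT.
case: p pp up vE {pa} => [|w [|w' p]] //=.
  by move=> _ _ vE; move: uv; rewrite vE tadj_irr.
by move=> + _ vE; rewrite -vE /= !eqxx /= andbF.
Qed.

(** A path inside the branch at [a] never meets [v], so it survives the deletion of the edge from
    [v] to [u]; the step from [v] to [a] is put in front of it. *)
Lemma cut_rel_child u v a y : adj v a -> a != u ->
  connect (cut_rel a v) a y -> connect (cut_rel v u) v y.
Proof.
move=> va au /connectP[p pp yE].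
have vNp : v \notin a :: p.
  apply/negP => vp; have := @cut_rel_separates a v.
  by rewrite tadj_sym va (path_connect pp vp) => /(_ isT).
have pa : path adj a p by apply: sub_path pp => x z /cut_rel_sub.
apply: (@connect_trans _ _ a).
  apply: connect1; rewrite /= va /= (negPf au) andbF /=.
  by apply/negP => /andP[_ /eqP av]; rewrite av inE eqxx in vNp.
apply/connectP; exists p => //.
have := @path_avoid_cut u v a p pa vNp.
by apply: sub_path => x z /=; rewrite orbC [(x == u) && _]andbC.
Qed.

Lemma cut_rel_cover u v y : connect (cut_rel v u) v y ->
  y = v \/ exists a, [/\ adj v a, a != u & connect (cut_rel a v) a y].
Proof.
move=> /connectP[p0 /shortenP[p pp up _] yE].
case: p pp up yE => [|a p] /=; first by left.
move=> /andP[/andP[va vNa] pp] /andP[vNp up] yE; right; exists a; split => //.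
  by apply: contraNneq vNa => ->; rewrite !eqxx.
apply/connectP; exists p => //; apply: path_avoid_cut => //.
by apply: sub_path pp => x z /cut_rel_sub.
Qed.

(** Along a path from [u] to [y], crossing the deleted edge lands on [u] or [v] itself, where
    connectivity starts afresh. *)
Lemma cut_rel_total u v y : adj u v ->
  connect (cut_rel u v) u y || connect (cut_rel v u) v y.
Proof.
move=> uv; have /connectP[p pp ->] := tconnected u y.
suff gen x : connect (cut_rel u v) u x || connect (cut_rel v u) v x ->
    path adj x p ->
    connect (cut_rel u v) u (last x p) || connect (cut_rel v u) v (last x p).
  by apply: gen; rewrite ?connect0.
elim: p x {pp} => [|z p IH] x //= cx /andP[xz]; apply: IH.
have [xz_uv|nxz] := boolP (((x == u) && (z == v)) || ((x == v) && (z == u))).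
  by case/orP: xz_uv => /andP[_ /eqP->]; rewrite connect0 ?orbT.
case/orP: cx => cx; apply/orP; [left|right];
  apply: (connect_trans cx); apply: connect1; rewrite /= xz //=.
by rewrite orbC.
Qed.

(** Among the oriented edges with at least a third of [S] on their first side, take one whose first
    side has fewest vertices. The branches one step further are strictly smaller, hence hold less
    than a third each; there are at most two, so this side holds at most two thirds of [S]. *)
Lemma balanced_edge (S : {set 'I_N}) : (3 < #|S|)%N -> exists u v,
  [/\ adj u v, (#|S| <= 3 * #|S :&: side u v|)%N
    & (#|S| <= 3 * #|S :\: side u v|)%N].
Proof.
move=> S3.
pose heavy (e : 'I_(nv T) * 'I_(nv T)) :=
  adj e.1 e.2 && (#|S| <= 3 * #|S :&: side e.1 e.2|)%N.
pose size_of (e : 'I_(nv T) * 'I_(nv T)) :=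
  #|[set y | connect (cut_rel e.1 e.2) e.1 y]|.
have [e0 he0] : exists e, heavy e.
  have /card_gt0P[i iS] : (0 < #|S|)%N by apply: leq_trans S3.
  have /eqP d1 := leaf_deg T i.
  have /card_gt0P[w] : (0 < #|[set w | adj (leaf T i) w]|)%N.
    by rewrite -degE d1.
  rewrite inE => iw.
  (* The two sides of an edge at a leaf cover [S], so one of them is heavy. *)
  have : (#|S| <= #|S :&: side (leaf T i) w| + #|S :&: side w (leaf T i)|)%N.
    rewrite -cardsUI; apply: leq_trans (leq_addr _ _).
    rewrite -finset.setIUr subset_leq_card //; apply/fintype.subsetP => j jS.
    by rewrite !inE jS /= cut_rel_total.
  have [h|h] := leqP #|S| (3 * #|S :&: side (leaf T i) w|).
    by exists (leaf T i, w); rewrite /heavy iw h.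
  move=> h2; exists (w, leaf T i); rewrite /heavy tadj_sym iw /=.
  by move: h h2; move: #|S| #|S :&: side _ w| #|S :&: side w _| => a b c; lia.
case: (@arg_minnP _ e0 heavy size_of he0) => -[v u] /= /andP[/= vu hS] mine.
exists v, u; split => //.
have child a : adj v a -> a != u -> (3 * #|S :&: side a v| < #|S|)%N.
  move=> va au; rewrite ltnNge; apply/negP => ha.
  have := mine (a, v); rewrite /heavy /= tadj_sym va ha => /(_ isT).
  rewrite leqNgt => /negP; apply; apply: proper_card; apply/properP; split.
    by apply/fintype.subsetP => y; rewrite !inE; apply: cut_rel_child.
  exists v; rewrite !inE ?connect0 //; apply: cut_rel_separates.
  by rewrite tadj_sym.
suff : (3 * #|S :&: side v u| <= 2 * #|S|)%N.
  have := cardsID (side v u) S.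
  by move: #|S| #|S :&: _| #|S :\: _| => a b c; lia.
have := tdeg v; rewrite degE => /orP[d|d].
  (* If [v] is a leaf, its branch is [v] alone and carries at most one qubit. *)
  have nou a : adj v a -> a = u.
    move: d => /cards1P[b bE] va.
    have : a \in [set w | adj v w] by rewrite inE.
    have : u \in [set w | adj v w] by rewrite inE.
    by rewrite bE !inE => /eqP-> /eqP.
  have : (#|S :&: side v u| <= 1)%N.
    apply: (@leq_trans #|[set i | leaf T i == v]|).
      apply/subset_leq_card/fintype.subsetP => i; rewrite !inE => /andP[_].
      move=> /cut_rel_cover[-> //|[a [va au _]]].
      by rewrite (nou _ va) eqxx in au.
    rewrite leqNgt; apply/negP => /card_gt1P[i [j []]].
    by rewrite !inE => /eqP iv /eqP jv /eqP[]; apply: (@leaf_inj _ T); rewrite iv.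
  by move: S3; move: #|S| #|S :&: _| => a b; lia.
have : (#|[set w | adj v w] :\ u| == 2)%N.
  by have := cardsD1 u [set w | adj v w]; rewrite (eqP d) inE vu => -[/esym/eqP].
move=> /cards2P[a [b [ab abE]]].
have [va au] : adj v a /\ a != u.
  by apply/andP; rewrite andbC; have : a \in [set w | adj v w] :\ u;
    [rewrite abE !inE eqxx | rewrite !inE].
have [vb bu] : adj v b /\ b != u.
  by apply/andP; rewrite andbC; have : b \in [set w | adj v w] :\ u;
    [rewrite abE !inE eqxx orbT | rewrite !inE].
have : (#|S :&: side v u| <= #|S :&: side a v| + #|S :&: side b v|)%N.
  rewrite -cardsUI; apply: leq_trans (leq_addr _ _).
  apply/subset_leq_card/fintype.subsetP => i; rewrite !inE => /andP[iS].
  move=> /cut_rel_cover[iv|[c [vc cu cy]]].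
    by have := leaf_deg T i; rewrite iv degE (eqP d).
  have : c \in [set w | adj v w] :\ u by rewrite !inE cu vc.
  by rewrite abE !inE iS => /orP[/eqP<-|/eqP<-]; rewrite cy ?orbT.
have := child _ va au; have := child _ vb bu.
by move: #|S| #|S :&: side v u| #|S :&: side a v| #|S :&: side b v| => x y z t; lia.
Qed.

End BalancedEdge.

(** * Cuts of the grid *)

(** Each edge of the grid occurs in one orientation only, so a sum over ordered pairs counts it
    once. *)
Definition grid_edge m (p q : 'I_m * 'I_m) : bool :=
  ((p.1 == q.1) && (q.2 == p.2.+1 :> nat)) || ((p.2 == q.2) && (q.1 == p.1.+1 :> nat)).

(** An induced matching across the cut: the cut adjacency matrix restricted to the endpoints is the
    identity. The exclusive or symmetrizes [E] modulo 2, as the signs of a graph state do. *)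
Definition cut_matching (V : finType) (E : rel V) (A : {set V}) (I : {set V * V}) :=
  (forall p, p \in I -> (p.1 \in A) && (p.2 \notin A)) /\
  (forall p q, p \in I -> q \in I -> E p.1 q.2 (+) E q.2 p.1 = (p == q)).

(** A discrete intermediate value argument: if neighbours always agreed, [g] would be constant, by
    induction on the distance. *)
Lemma mixed_line_step m (g : 'I_m -> bool) a b : g a -> ~~ g b ->
  exists c d : 'I_m, [/\ g c, ~~ g d & (d == c.+1 :> nat) || (c == d.+1 :> nat)].
Proof.
move=> ga gb.
have key (x : 'I_m) : forall k, (k + x < m)%N ->
    (forall c d : 'I_m, d = c.+1 :> nat -> g c = g d) ->
    forall z : 'I_m, z = (k + x)%N :> nat -> g z = g x.
  elim=> [|k IH] kx st z zE; first by congr g; apply: val_inj.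
  have kxm : (k + x < m)%N by lia.
  by rewrite -(st (Ordinal kxm) z) //= (IH kxm st (Ordinal kxm)).
have [[c [d [dE cd]]]|nostep] : (exists c d : 'I_m, d = c.+1 :> nat /\ g c != g d)
    \/ (forall c d : 'I_m, d = c.+1 :> nat -> g c = g d).
  have [/existsP[c /existsP[d /andP[/eqP dE cd]]]|h] :=
    boolP [exists c : 'I_m, exists d : 'I_m, (d == c.+1 :> nat) && (g c != g d)].
    by left; exists c, d.
  right=> c d dE; apply/eqP; apply: contraNT h => cd.
  by apply/existsP; exists c; apply/existsP; exists d; rewrite dE eqxx.
- case gc : (g c) cd => gd.
    by exists c, d; split; rewrite ?gc ?dE ?eqxx //; case: (g d) gd.
  by exists d, c; split; rewrite ?gc ?dE ?eqxx ?orbT //; case: (g d) gd.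
exfalso; have [ab|ba] := leqP a b.
  have bm := ltn_ord b.
  by move: gb; rewrite (key a (b - a)%N _ nostep b) ?ga //; lia.
have am := ltn_ord a.
by move: ga; rewrite (key b (a - b)%N _ nostep a) ?(negPf gb) //; lia.
Qed.

(** Each row of [X] is mixed and so contains a cut edge. Distinct rows of equal parity are not
    adjacent, so no grid edge joins two of the chosen edges. *)
Lemma grid_matching_rows m (A : {set 'I_m * 'I_m}) (X : {set 'I_m}) :
  (forall i j, i \in X -> j \in X -> odd i = odd j) ->
  (forall i, i \in X -> (exists j, (i, j) \in A) /\ (exists j, (i, j) \notin A)) ->
  exists2 I, cut_matching (@grid_edge m) A I & #|I| = #|X|.
Proof.
move=> par mixX.
have step i : exists cd : 'I_m * 'I_m, (i \in X) ==> [&& (i, cd.1) \in A, (i, cd.2) \notin A &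
     (cd.2 == cd.1.+1 :> nat) || (cd.1 == cd.2.+1 :> nat)].
  case iX : (i \in X); last by exists (i, i).
  have [[a Aa] [b Ab]] := mixX i iX.
  have [c [d [? ? ?]]] := @mixed_line_step m (fun j => (i, j) \in A) a b Aa Ab.
  by exists (c, d); apply/and3P.
pose cd i := xchoose (step i).
have cdP i : i \in X -> [&& (i, (cd i).1) \in A, (i, (cd i).2) \notin A &
     ((cd i).2 == (cd i).1.+1 :> nat) || ((cd i).1 == (cd i).2.+1 :> nat)].
  by move=> iX; apply: (implyP (xchooseP (step i)) iX).
pose h i := ((i, (cd i).1), (i, (cd i).2)).
have hinj : injective h by move=> i j [].
exists (h @: X); last by rewrite card_imset.
split=> [p /imsetP[i iX ->]|p q /imsetP[i iX ->] /imsetP[j jX ->]] /=.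
  by have /and3P[-> ->] := cdP i iX.
rewrite (inj_eq hinj) /grid_edge /=.
have [<-|ij] := eqVneq i j.
  have /and3P[_ _] := cdP i iX.
  have -> : (i == i.+1 :> nat) = false by lia.
  by rewrite !andbF !orbF; case: eqP => [->|_] //= _; case: eqP => //; lia.
have -> : (j == i.+1 :> nat) = false by have := par _ _ iX jX; lia.
have -> : (i == j.+1 :> nat) = false by have := par _ _ iX jX; lia.
by rewrite !andbF.
Qed.

Lemma grid_matching_cols m (A : {set 'I_m * 'I_m}) (X : {set 'I_m}) :
  (forall i j, i \in X -> j \in X -> odd i = odd j) ->
  (forall j, j \in X -> (exists i, (i, j) \in A) /\ (exists i, (i, j) \notin A)) ->
  exists2 I, cut_matching (@grid_edge m) A I & #|I| = #|X|.
Proof.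
move=> par mixX.
pose sw (p : 'I_m * 'I_m) := (p.2, p.1).
have swK : involutive sw by case.
pose sw2 (e : ('I_m * 'I_m) * ('I_m * 'I_m)) := (sw e.1, sw e.2).
have sw2I : injective sw2 by move=> [[? ?] [? ?]] [[? ?] [? ?]] [-> -> -> ->].
have [|I [IA IE] cI] := @grid_matching_rows m (sw @^-1: A) X par.
  by move=> j /mixX[[a Aa] [b Ab]]; split; [exists a | exists b]; rewrite inE.
exists (sw2 @: I); last by rewrite card_imset.
split=> [p /imsetP[e eI ->]|p q /imsetP[e eI ->] /imsetP[f fI ->]] /=.
  by have := IA e eI; rewrite !inE.
by rewrite (inj_eq sw2I) -(IE e f eI fI) /grid_edge /= orbC [X in _ (+) X]orbC.
Qed.

Lemma same_parity_subset m (X : {set 'I_m}) k : (2 * k <= #|X|)%N ->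
  exists Y : {set 'I_m}, [/\ Y \subset X, (k <= #|Y|)%N &
    forall i j, i \in Y -> j \in Y -> odd i = odd j].
Proof.
move=> kX; have cX := cardsID [set i : 'I_m | odd i] X.
have [h|h] := leqP k #|X :&: [set i : 'I_m | odd i]|.
  exists (X :&: [set i : 'I_m | odd i]); split=> //; first exact: finset.subsetIl.
  by move=> i j; rewrite !inE => /andP[_ ->] /andP[_ ->].
exists (X :\: [set i : 'I_m | odd i]); split=> //.
- exact: finset.subsetDl.
- by move: kX h cX; move: #|X| #|X :&: _| #|X :\: _| => a b c; lia.
- by move=> i j; rewrite !inE => /andP[/negPf-> _] /andP[/negPf-> _].
Qed.

(** Fewer than [m / 3] rows cannot contain a third of the grid, so [A] meets a row outside [X], and
    purity puts that whole row in [A]. *)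
Lemma pure_row m (A : {set 'I_m * 'I_m}) (X : {set 'I_m}) :
  (m * m <= 3 * #|A|)%N -> (3 * #|X| < m)%N ->
  (forall i, i \notin X -> (exists j, (i, j) \in A) -> forall j, (i, j) \in A) ->
  exists i, forall j, (i, j) \in A.
Proof.
move=> cA cX pureX.
have [/existsP[i /andP[iX /existsP ij]]|h] :=
    boolP [exists i, (i \notin X) && [exists j, (i, j) \in A]].
  by exists i; apply: pureX.
have : (#|A| <= #|X| * m)%N.
  rewrite -[m in (_ * m)%N](card_ord m) -cardsT -cardsX.
  apply/subset_leq_card/fintype.subsetP => -[i j] ijA; rewrite !inE andbT /=.
  apply: contraNT h => iX; apply/existsP; exists i; rewrite iX.
  by apply/existsP; exists j.
have : (3 * (#|X| * m) < m * m)%N.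
  by rewrite mulnA ltn_mul2r cX andbT; apply: leq_ltn_trans cX.
move: cA; move: (m * m)%N (_ * m)%N #|A| => a b c; lia.
Qed.

(** With [2 k] mixed rows, one parity class supplies [k] of them. Otherwise fewer than a third of
    the rows are mixed, which the side length [6 (k + 1)] guarantees; then both [A] and its
    complement contain a full row, and every column is mixed. *)
Lemma grid_balanced_matching k (A : {set 'I_(6 * k.+1) * 'I_(6 * k.+1)}) :
  ((6 * k.+1) * (6 * k.+1) <= 3 * #|A|)%N ->
  ((6 * k.+1) * (6 * k.+1) <= 3 * #|~: A|)%N ->
  exists2 I, cut_matching (@grid_edge _) A I & (k <= #|I|)%N.
Proof.
set m := (6 * k.+1)%N => cA cB.
pose X := [set i : 'I_m | [exists j, (i, j) \in A] && [exists j, (i, j) \notin A]].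
have [kX|Xk] := leqP (2 * k) #|X|.
  have [Y [YX kY par]] := same_parity_subset kX.
  have [|I HI cI] := @grid_matching_rows m A Y par.
    by move=> i /(fintype.subsetP YX); rewrite inE => /andP[/existsP ? /existsP ?].
  by exists I => //; rewrite cI.
have X3 : (3 * #|X| < m)%N by move: Xk; rewrite /m; move: #|X| => x; lia.
have [i iA] : exists i, forall j, (i, j) \in A.
  apply: (pure_row cA X3) => i; rewrite inE negb_and => iX [j ijA] l.
  apply: contraTT iX => il; rewrite negb_or !negbK.
  by apply/andP; split; apply/existsP; [exists j | exists l].
have [i' iB] : exists i, forall j, (i, j) \in ~: A.
  apply: (pure_row cB X3) => {iA}i; rewrite inE negb_and => iX [j ijA] l.
  apply: contraTT iX; rewrite inE negbK => il; rewrite negb_or !negbK.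
  rewrite inE in ijA.
  by apply/andP; split; apply/existsP; [exists l | exists j].
have [|Y [YX kY par]] := @same_parity_subset m [set: 'I_m] k.
  by rewrite cardsT card_ord /m; lia.
have [|I HI cI] := @grid_matching_cols m A Y par.
  by move=> j _; split; [exists i | exists i'; have := iB j; rewrite inE].
by exists I => //; rewrite cI.
Qed.

(** * Entropy and rank of Gram matrices *)

Lemma char_poly_conj (F : fieldType) n (P D : 'M[F]_n) : P \in unitmx ->
  char_poly (invmx P *m D *m P) = char_poly D.
Proof.
move=> Pu; rewrite /char_poly.
suff -> : char_poly_mx (invmx P *m D *m P) =
    map_mx polyC (invmx P) *m char_poly_mx D *m map_mx polyC P.
  rewrite !det_mulmx mulrC mulrA -det_mulmx -map_mxM mulmxV // map_mx1 det1.
  by rewrite mul1r.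
rewrite /char_poly_mx mulmxBr mulmxBl -!map_mxM mul_mx_scalar -scalemxAl.
by rewrite -map_mxM mulVmx // map_mx1 scalemx1.
Qed.

(** Compressing to the support by the selection matrix [S] leaves an invertible diagonal matrix. *)
Lemma rank_diag_mx_ge (F : fieldType) n (d : 'rV[F]_n) :
  (#|[set i | (d 0 i != 0)%R]%SET| <= \rank (diag_mx d))%N.
Proof.
set I := [set i | (d 0 i != 0)%R]%SET.
pose S : 'M[F]_(#|I|, n) := \matrix_(i, j) (enum_val i == j)%:R.
have <- : \rank (S *m diag_mx d *m S^T) = #|I|.
  apply: mxrank_unit; rewrite unitmxE unitfE.
  have -> : S *m diag_mx d *m S^T = diag_mx (\row_i d 0 (enum_val i)).
    apply/matrixP => i j; rewrite !mxE (bigD1 (enum_val i)) //= big1 => [|k ki].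
      rewrite addr0 mul_mx_diag !mxE eqxx mul1r (inj_eq enum_val_inj) eq_sym.
      by case: eqP => [->|]; rewrite (mulr1, mulr0).
    by rewrite mul_mx_diag !mxE eq_sym (negPf ki) !mul0r.
  rewrite det_diag prodf_seq_neq0; apply/allP => i _ /=.
  by rewrite mxE; have := enum_valP i; rewrite inE.
exact: leq_trans (mxrankM_maxl _ _) (mxrankM_maxr _ _).
Qed.

Section GramSpectrum.
Variables (R : realType) (n p : nat) (X : 'M[R[i]]_(n, p)).
Let M := X *m X^t*.

Lemma gram_spectrum : exists d : 'I_n -> R,
  [/\ forall i, 0 <= d i,
      char_poly M = \prod_i ('X - (d i)%:C%C%:P),
      \tr M = (\sum_i d i)%:C%C,
      \tr (M *m M) = (\sum_i d i ^+ 2)%:C%C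
    & (#|[set i | (d i != 0)%R]%SET| <= \rank M)%N].
Proof.
have herm : M^t* = M by rewrite /M trmx_mul map_mxM trmxCK.
have Mn : M \is normalmx by apply/normalmxP; rewrite herm.
set P := spectralmx M; set D := spectral_diag M.
have Pu : P \is unitarymx := spectral_unitarymx M.
have Pi : P \in unitmx := unitarymx_unit Pu.
have ME : M = invmx P *m diag_mx D *m P := orthomx_spectralP Mn.
(* A unitary conjugate of a Gram matrix is again a Gram matrix, so its diagonal entries are sums of
   squared moduli. *)
have DE : diag_mx D = (P *m X) *m (P *m X)^t*.
  rewrite trmx_mul map_mxM mulmxA -[P *m X *m _]mulmxA -/M ME.
  by rewrite -invmx_unitary // !mulmxA mulmxV // mul1mx -mulmxA mulmxV // mulmx1.
have D0 i : 0 <= D 0 i.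
  have -> : D 0 i = (diag_mx D) i i by rewrite mxE eqxx.
  rewrite DE mxE; apply: sumr_ge0 => j _.
  by rewrite !mxE mul_conjC_ge0.
pose d i := complex.Re (D 0 i).
have dE i : D 0 i = (d i)%:C%C.
  by have := D0 i; rewrite lecE /= /d => /andP[/eqP Im0 _]; case: (D 0 i) Im0 => a b /= ->.
exists d; split.
- by move=> i; have := D0 i; rewrite lecE /= => /andP[].
- rewrite ME char_poly_conj // char_poly_trig ?diag_mx_is_trig //.
  by apply: eq_bigr => i _; rewrite mxE eqxx mulr1n dE.
- rewrite ME mxtrace_mulC mulmxA mulmxV // mul1mx mxtrace_diag rmorph_sum.
  by apply: eq_bigr => i _; rewrite dE.
- have -> : M *m M = invmx P *m (diag_mx D *m diag_mx D) *m P.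
    by rewrite {1 2}ME !mulmxA mulmxK.
  rewrite -mulmxA mxtrace_mulC mulmxK // mulmx_diag mxtrace_diag rmorph_sum.
  by apply: eq_bigr => i _; rewrite rmorphXn /= mxE dE expr2.
- have -> : \rank M = \rank (diag_mx D).
    rewrite ME mxrankMfree ?row_free_unit //.
    by rewrite -mxrank_tr trmx_mul mxrankMfree ?mxrank_tr // row_free_unit unitmx_tr unitmx_inv.
  apply: leq_trans (rank_diag_mx_ge _).
  apply/subset_leq_card/fintype.subsetP => i.
  by rewrite !inE; apply: contraNneq; rewrite /d => ->.
Qed.

(** The Rényi entropy of order 2 bounds the von Neumann entropy from below; a tangent line of the
    logarithm replaces Jensen's inequality. *)
Lemma gram_entropy_ge (q : R) : 0 < q -> \tr M = 1 -> complex.Re (\tr (M *m M)) <= q ->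
  - log2 q <= vn_entropy M.
Proof.
move=> q0 + +.
have [d [d0 Mc -> -> _]] := gram_spectrum => trd /= trd2.
have {}trd : \sum_i d i = 1 by case: trd.
rewrite /vn_entropy.
(* The default value 0 is never taken, since the [d i] give a factorization; unique factorization
   makes any chosen list of roots a permutation of them. *)
case: xgetP => [h _ [s [sM ->]]|none]; last first.
  have := none (\sum_i negxlog2x (d i)); case.
  exists [seq (d i)%:C%C | i <- index_enum 'I_n]; split; first by rewrite big_map.
  by rewrite big_map.
have ps : perm_eq s [seq (d i)%:C%C | i <- index_enum 'I_n].
  by apply: prod_XsubC_eq; rewrite big_map -sM.
rewrite (perm_big _ ps) big_map /=.
have ln2 : 0 < ln (2 : R) by apply: ln_gt0; lra.
(* [-ln t >= 1 - t/q - ln q], averaged with weights [d i]. *)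
have term i : d i * (1 - d i / q - ln q) / ln 2 <= negxlog2x (d i).
  rewrite /negxlog2x /log2; have [->|di] := eqVneq (d i) 0; first by rewrite !mul0r.
  have dip : 0 < d i by rewrite lt_def di d0.
  have -> : - (d i * (ln (d i) / ln 2)) = d i * - ln (d i) / ln 2.
    by rewrite mulrN mulNr mulrA.
  rewrite ler_pM2r ?invr_gt0 // ler_pM2l //.
  have : ln (d i / q) <= d i / q - 1.
    have := @le_ln1Dx R (d i / q - 1); rewrite [1 + _]addrC subrK; apply.
    by rewrite ltrBrDr addNr divr_gt0.
  by rewrite ln_div ?posrE //; lra.
apply: le_trans (ler_sum _ (fun i _ => term i)).
rewrite -mulr_suml /log2 -mulNr ler_pM2r ?invr_gt0 //.
have -> : \sum_i d i * (1 - d i / q - ln q) =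
    (\sum_i d i) * (1 - ln q) - (\sum_i d i ^+ 2) / q.
  rewrite !mulr_suml -sumrB; apply: eq_bigr => i _; ring.
have : (\sum_i d i ^+ 2) / q <= 1 by rewrite ler_pdivrMr // mul1r.
by rewrite trd; lra.
Qed.

Lemma gram_log_rank_ge (q : R) : 0 < q -> \tr M = 1 -> complex.Re (\tr (M *m M)) <= q ->
  - log2 q <= log2 (\rank M)%:R.
Proof.
move=> q0 + +.
have [d [d0 _ -> -> rk]] := gram_spectrum => trd /= trd2.
have {}trd : \sum_i d i = 1 by case: trd.
have ln2 : 0 < ln (2 : R) by apply: ln_gt0; lra.
rewrite /log2 -mulNr ler_pM2r ?invr_gt0 // -lnV ?posrE //.
set r := (\rank M)%:R : R.
(* Cauchy-Schwarz on the support, as [2 d i q <= d i ^ 2 + q ^ 2] *)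
have key : 1 <= r * q.
  have : \sum_i (2 * d i * q) <= \sum_i (d i ^+ 2 + (d i != 0)%:R * q ^+ 2).
    apply: ler_sum => i _; case: eqVneq => [->|_]; rewrite /=.
      by rewrite mulr0 !mul0r expr0n addr0.
    by rewrite mul1r; have := sqr_ge0 (d i - q); lra.
  (* Summed up, this reads [2 q <= q + r q^2], the support being at most the rank; dividing by [q]
     gives the claim. *)
  rewrite big_split /= -!mulr_suml -mulr_sumr trd mulr1.
  have -> : \sum_i (d i != 0)%:R = #|[set i | (d i != 0)%R]%SET|%:R :> R.
    rewrite -sum1_card natr_sum [RHS]big_mkcond /=; apply: eq_bigr => i _.
    by rewrite inE; case: eqP.
  have : (#|[set i | (d i != 0)%R]%SET|%:R <= r) by rewrite ler_nat.
  nra.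
have r0 : 0 < r by nra.
rewrite ler_ln ?posrE ?invr_gt0 //.
by rewrite -div1r ler_pdivrMr.
Qed.

End GramSpectrum.

(** * Purity under LOCC *)

Lemma sum_ord_enum (T : finType) (V : nmodType) (F : T -> V) :
  \sum_(i < #|T|) F (enum_val i) = \sum_x F x.
Proof.
rewrite [RHS](reindex_onto enum_val enum_rank) /=; last by move=> k _; rewrite enum_rankK.
by apply: eq_bigl => k; rewrite enum_valK eqxx.
Qed.

(** * Splitting and recombining configurations across a cut *)

Section Glue.
Variables (N : nat).
Implicit Types (x y z : cfg N) (A : {set 'I_N}).

Lemma glueC A x y : glue (~: A) x y = glue A y x.
Proof. by apply/ffunP => i; rewrite !ffunE inE; case: (i \in A). Qed.

Lemma glueKl A x y : glue A (glue A x y) (glue A y x) = x.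
Proof. by apply/ffunP => i; rewrite !ffunE; case: (i \in A). Qed.

Lemma glue_gluel A x y z : glue A (glue A x y) z = glue A x z.
Proof. by apply/ffunP => i; rewrite !ffunE; case: (i \in A). Qed.

Lemma glue_gluer A x y z : glue A x (glue A y z) = glue A x z.
Proof. by apply/ffunP => i; rewrite !ffunE; case: (i \in A). Qed.

(** Exchanging the parts of [x] and [y] outside [A] is an involution on pairs. This is the change of
    variables behind the purity computations. *)
Lemma sum_glue_swap (V : nmodType) A (F : cfg N -> cfg N -> V) :
  \sum_x \sum_y F (glue A x y) (glue A y x) = \sum_x \sum_y F x y.
Proof.
rewrite !pair_big /=.
pose sw (p : cfg N * cfg N) := (glue A p.1 p.2, glue A p.2 p.1).
have swK : involutive sw by case=> x y; rewrite /sw /= !glueKl.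
by rewrite [RHS](reindex_inj (inv_inj swK)).
Qed.

(** Every configuration arises twice, from itself and from its flip at [k]. This isolates the bit of
    a measured qubit. *)
Lemma sum_setq (V : nmodType) k (F : cfg N -> V) :
  \sum_x \sum_(b : bool) F (setq x k b) = (\sum_x F x) *+ 2.
Proof.
pose fl x := setq x k (~~ x k).
have flK : involutive fl.
  by move=> x; apply/ffunP => i; rewrite !ffunE; case: eqP => // ->; rewrite eqxx negbK.
rewrite mulr2n [X in _ = _ + X](reindex_inj (inv_inj flK)) -big_split /=; apply: eq_bigr => x _.
rewrite big_bool /fl.
have <- : setq x k (x k) = x by apply/ffunP => i; rewrite !ffunE; case: eqP => // ->.
have sE b b' : setq (setq x k b) k b' = setq x k b'.
  by apply/ffunP => i; rewrite !ffunE; case: eqP.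
rewrite !sE; have -> : setq x k (x k) k = x k by rewrite ffunE eqxx.
by case: (x k) => //=; rewrite addrC.
Qed.

Definition restr A x : cfg N := [ffun i => (i \in A) && x i].

Lemma restr_on A x : [forall i, (i \notin A) ==> ~~ restr A x i].
Proof. by apply/forallP => i; rewrite ffunE; case: (i \in A). Qed.

Definition to_on A x : cfgOn A := exist _ (restr A x) (restr_on A x).

Lemma restr_id A (a : cfgOn A) : restr A (val a) = val a.
Proof.
apply/ffunP => i; rewrite ffunE; have /forallP/(_ i) := valP a.
by case: (i \in A) => //= /negPf ->.
Qed.

Lemma sum_cfgOn (V : nmodType) A (F : cfg N -> V) :
  \sum_(a : cfgOn A) \sum_(z : cfgOn (~: A)) F (glue A (val a) (val z)) = \sum_x F x.
Proof.
rewrite pair_big /=.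
pose h x : cfgOn A * cfgOn (~: A) := (to_on A x, to_on (~: A) x).
rewrite (reindex h) /=; last first.
  exists (fun p => glue A (val p.1) (val p.2)) => [x _|[a z] _].
    by apply/ffunP => i; rewrite !ffunE /= inE; case: (i \in A).
  congr pair; apply: val_inj => /=.
    rewrite -[RHS]restr_id; apply/ffunP => i; rewrite !ffunE /=.
    by case: (i \in A).
  rewrite -[RHS]restr_id; apply/ffunP => i; rewrite !ffunE /= inE.
  by case: (i \in A).
apply: eq_bigr => x _; congr F; apply/ffunP => i; rewrite !ffunE /= inE.
by case: (i \in A).
Qed.

End Glue.

(** * Purity in terms of amplitudes, and its behaviour under local measurements *)

Section Purity.
Variable R : realType.
Local Notation C := (complex R).
Variable N : nat.
Implicit Types (psi : qst R N) (A : {set 'I_N}).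

(** The trace of the squared reduced matrix, its two indices on [A] and two on the complement being
    merged into two full configurations. *)
Definition purity psi A : C := \sum_(x : cfg N) \sum_(y : cfg N)
  psi x * (psi (glue A y x))^* * (psi y * (psi (glue A x y))^*).

Definition weight psi : C := \sum_(x : cfg N) psi x * (psi x)^*.

Lemma weightE psi : weight psi = (sqnorm psi)%:C%C.
Proof.
rewrite /weight /sqnorm rmorph_sum; apply: eq_bigr => x _ /=.
by rewrite -normCK normc_def -rmorphXn.
Qed.

Lemma weight_ge0 psi : 0 <= weight psi.
Proof. by apply: sumr_ge0 => x _; apply: mul_conjC_ge0. Qed.

Definition amp_mx psi A : 'M[C]_(#|{: cfgOn A}|, #|{: cfgOn (~: A)}|) :=
  \matrix_(i, j) psi (glue A (val (enum_val i)) (val (enum_val j))).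

Lemma rho_gram psi A : rho psi A = amp_mx psi A *m (amp_mx psi A)^t*.
Proof.
apply/matrixP => i j; rewrite !mxE [LHS](reindex_onto enum_val enum_rank) /=; last first.
  by move=> k _; rewrite enum_rankK.
apply: eq_big => k; first by rewrite enum_valK eqxx.
by move=> _; rewrite !mxE.
Qed.

Lemma trace_rho psi A : \tr (rho psi A) = weight psi.
Proof.
rewrite /weight -(sum_cfgOn A) -sum_ord_enum; apply: eq_bigr => i _.
by rewrite mxE.
Qed.

Lemma trace_rho2 psi A : \tr (rho psi A *m rho psi A) = purity psi A.
Proof.
rewrite /purity -(sum_cfgOn A) -sum_ord_enum; apply: eq_bigr => i _.
rewrite mxE.
under [RHS]eq_bigr => z _ do rewrite -(sum_cfgOn A) -sum_ord_enum.
rewrite [RHS]exchange_big /=; apply: eq_bigr => j _.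
rewrite !mxE mulr_suml; apply: eq_bigr => z _.
rewrite mulr_sumr; apply: eq_bigr => w _.
by rewrite !glue_gluel !glue_gluer.
Qed.

(** Passing to the complement only exchanges the two conjugated factors. *)
Lemma purityC psi A : purity psi (~: A) = purity psi A.
Proof.
rewrite /purity; apply: eq_bigr => x _; apply: eq_bigr => y _.
by rewrite !glueC; ring.
Qed.

(* The operator on the complement of [A] obtained by tracing out [A], indexed by
   full configurations (hence with multiplicities). *)
Definition red psi A (w w' : cfg N) : C :=
  \sum_(x : cfg N) psi (glue A x w) * (psi (glue A x w'))^*.

(** This is the purity of the complement up to multiplicity: the idle bits of [w] and [w'] on [A],
    and those of the two traced configurations off [A], contribute [4 ^ N] together. *)
Lemma red_sqnorm psi A :
  \sum_w \sum_w' `|red psi A w w'| ^+ 2 = (4 ^ N)%:R * purity psi A.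
Proof.
transitivity (\sum_(w : cfg N) \sum_(w' : cfg N) \sum_(x : cfg N) \sum_(y : cfg N)
   psi (glue A x w) * (psi (glue A x w'))^* * (psi (glue A y w') * (psi (glue A y w))^*)).
  apply: eq_bigr => w _; apply: eq_bigr => w' _.
  rewrite normCK rmorph_sum /= /red mulr_suml; apply: eq_bigr => x _.
  rewrite mulr_sumr; apply: eq_bigr => y _.
  by rewrite rmorphM /= conjCK [X in _ = _ * X]mulrC.
under eq_bigr => w _ do rewrite exchange_big /=.
rewrite exchange_big /=.
(* First [y] and [w'], then [x] and [w], are recombined by [sum_glue_swap]; each time one variable
   becomes idle and yields a factor [2 ^ N]. *)
under eq_bigr => x _.
  under eq_bigr => w _.
    rewrite exchange_big /=.
    have -> : \sum_(y : cfg N) \sum_(w' : cfg N)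
      psi (glue A x w) * (psi (glue A x w'))^* * (psi (glue A y w') * (psi (glue A y w))^*)
      = \sum_(y : cfg N) \sum_(w' : cfg N)
      psi (glue A x w) * (psi (glue A (glue A x w) (glue A y w')))^* *
        (psi (glue A y w') * (psi (glue A (glue A y w') (glue A x w)))^*).
      by apply: eq_bigr => y _; apply: eq_bigr => w' _; rewrite !glue_gluel !glue_gluer.
    rewrite (sum_glue_swap A (fun y _ => psi (glue A x w) * (psi (glue A (glue A x w) y))^* *
        (psi y * (psi (glue A y (glue A x w)))^*))).
    over.
  over.
rewrite /=.
rewrite (sum_glue_swap A (fun x _ => \sum_(y : cfg N) \sum_(_ : cfg N)
   psi x * (psi (glue A x y))^* * (psi y * (psi (glue A y x))^*))).
under eq_bigr => x _ do rewrite sumr_const.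
rewrite sumrMnl.
under eq_bigr => x _ do under eq_bigr => y _ do rewrite sumr_const.
under eq_bigr => x _ do rewrite sumrMnl.
rewrite sumrMnl -mulrnA card_ffun card_bool card_ord -expnD addnn -mul2n.
rewrite expnM -[LHS]mulr_natl; congr (_ * _).
by apply: eq_bigr => x _; apply: eq_bigr => y _; ring.
Qed.

Lemma glue_setq A k x w b : k \in A -> setq (glue A x w) k b = glue A (setq x k b) w.
Proof.
by move=> kA; apply/ffunP => i; rewrite !ffunE; case: eqP => // ->; rewrite kA.
Qed.

(** The measured qubit is traced out, so the Kraus operators enter only through the sum of
    [M^dagger M], which is the identity. *)
Lemma red_kraus psi A k m (ops : 'I_m -> qop R) w w' :
  k \in A -> kraus_complete ops ->
  \sum_i red (apply_local k (ops i) psi) A w w' = red psi A w w'.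
Proof.
(* Doubling both sides allows [sum_setq] to split off bit [k]. *)
move=> kA kr; apply: (mulIf (_ : 2%:R != 0 :> C)); first by rewrite pnatr_eq0.
rewrite !mulr_natr /red exchange_big /= -[in LHS](sum_setq k) -(sum_setq k).
apply: eq_bigr => x _.
pose f c := psi (glue A (setq x k c) w); pose g c := psi (glue A (setq x k c) w').
transitivity (\sum_(b : bool) \sum_(i < m) \sum_(c : bool) \sum_(c' : bool)
    (ops i b c * f c * (ops i b c' * g c')^*)).
  apply: eq_bigr => b _; apply: eq_bigr => i _.
  have sE b' : setq (setq x k b) k b' = setq x k b'.
    by apply/ffunP => j; rewrite !ffunE; case: eqP.
  rewrite !ffunE kA eqxx mulr_suml; apply: eq_bigr => c _.
  rewrite rmorph_sum mulr_sumr; apply: eq_bigr => c' _.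
  by rewrite !(glue_setq _ _ _ kA) !sE.
transitivity (\sum_(c : bool) \sum_(c' : bool) (c' == c)%:R * (f c * (g c')^*)).
  rewrite exchange_big /=.
  under eq_bigr => i _ do rewrite exchange_big /=.
  rewrite exchange_big /=; apply: eq_bigr => c _.
  under eq_bigr => i _ do rewrite exchange_big /=.
  rewrite exchange_big /=; apply: eq_bigr => c' _.
  rewrite -kr mulr_suml; apply: eq_bigr => i _; rewrite mulr_suml.
  by apply: eq_bigr => b _; rewrite rmorphM; ring.
apply: eq_bigr => c _; rewrite (bigD1 c) //= eqxx mul1r big1 ?addr0 // => c' /negPf->.
by rewrite mul0r.
Qed.

Lemma red_setT psi w w' : red psi [set: 'I_N]%SET w w' = weight psi.
Proof.
have gT x y : glue [set: 'I_N]%SET x y = x by apply/ffunP => i; rewrite ffunE inE.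
by apply: eq_bigr => x _; rewrite !gT.
Qed.

(** Conservation of probability, as the case of [red_kraus] where everything is traced out. *)
Lemma weight_kraus psi k m (ops : 'I_m -> qop R) : kraus_complete ops ->
  \sum_i weight (apply_local k (ops i) psi) = weight psi.
Proof.
move=> kr; pose w : cfg N := [ffun=> false].
rewrite -(red_setT psi w w) -(@red_kraus psi _ k m ops w w) ?inE //.
by apply: eq_bigr => i _; rewrite red_setT.
Qed.


Lemma purityZ psi A c :
  purity [ffun x => c * psi x] A = (c * c^*) ^+ 2 * purity psi A.
Proof.
rewrite /purity mulr_sumr; apply: eq_bigr => x _; rewrite mulr_sumr.
by apply: eq_bigr => y _; rewrite !ffunE !rmorphM /=; ring.
Qed.

Lemma weightZ psi c : weight [ffun x => c * psi x] = c * c^* * weight psi.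
Proof.
rewrite /weight mulr_sumr; apply: eq_bigr => x _.
by rewrite !ffunE !rmorphM /=; ring.
Qed.

End Purity.

(** * The triangle inequality for the Frobenius norm in squared form *)

Section FrobeniusTriangle.
Variables (C : numClosedFieldType) (J : finType).

(** Minkowski's inequality without square roots. For positive [a] and [b] it follows from
    [a b (s + t)^2 <= (a + b) (b s^2 + a t^2)], the difference being [(b s - a t)^2]; if one of them
    vanishes, so does the corresponding function. *)
Lemma frobenius_add_le (F G : J -> C) (a b q : C) : 0 <= a -> 0 <= b ->
  \sum_j `|F j| ^+ 2 <= a ^+ 2 * q -> \sum_j `|G j| ^+ 2 <= b ^+ 2 * q ->
  \sum_j `|F j + G j| ^+ 2 <= (a + b) ^+ 2 * q.
Proof.
have zero (H : J -> C) : \sum_j `|H j| ^+ 2 <= 0 -> forall j, H j = 0.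
  move=> H0 j; apply/eqP; rewrite -normr_eq0 -sqrf_eq0.
  have /eqP : \sum_j `|H j| ^+ 2 = 0.
    by apply/eqP; rewrite eq_le H0 sumr_ge0 // => i _; apply: exprn_ge0.
  rewrite psumr_eq0 => [/allP/(_ j)|i _]; last exact: exprn_ge0.
  by rewrite mem_index_enum => /(_ isT).
move=> a0 b0 HF HG.
have [az|an] := eqVneq a 0.
  rewrite az expr0n mul0r in HF; rewrite az add0r.
  by under eq_bigr => j _ do rewrite (zero _ HF) add0r.
have [bz|bn] := eqVneq b 0.
  rewrite bz expr0n mul0r in HG; rewrite bz addr0.
  by under eq_bigr => j _ do rewrite (zero _ HG) addr0.
have ap : 0 < a by rewrite lt_def an.
have bp : 0 < b by rewrite lt_def bn.
have abp : 0 < a * b by apply: mulr_gt0.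
rewrite -(ler_pM2l abp).
apply: (@le_trans _ _ ((a + b) *
    (b * (\sum_j `|F j| ^+ 2) + a * (\sum_j `|G j| ^+ 2)))).
  rewrite !mulr_sumr -big_split /= mulr_sumr; apply: ler_sum => j _.
  apply: (@le_trans _ _ (a * b * (`|F j| + `|G j|) ^+ 2)).
    rewrite ler_pM2l // ler_pXn2r ?nnegrE ?addr_ge0 //; exact: ler_normD.
  rewrite -subr_ge0.
  have -> : (a + b) * (b * `|F j| ^+ 2 + a * `|G j| ^+ 2) -
     a * b * (`|F j| + `|G j|) ^+ 2 = (b * `|F j| - a * `|G j|) ^+ 2 by ring.
  by rewrite real_exprn_even_ge0 // realB // realM // ger0_real.
have -> : a * b * ((a + b) ^+ 2 * q) = (a + b) * (b * (a ^+ 2 * q) + a * (b ^+ 2 * q)).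
  by ring.
by rewrite ler_pM2l ?addr_gt0 // lerD // ler_pM2l.
Qed.

Lemma frobenius_sum_le m (G : 'I_m -> J -> C) (p : 'I_m -> C) (q : C) :
  (forall i, 0 <= p i) ->
  (forall i, \sum_j `|G i j| ^+ 2 <= p i ^+ 2 * q) ->
  \sum_j `|\sum_i G i j| ^+ 2 <= (\sum_i p i) ^+ 2 * q.
Proof.
move=> p0 Gp.
suff gen (s : seq 'I_m) : \sum_j `|\sum_(i <- s) G i j| ^+ 2 <=
    (\sum_(i <- s) p i) ^+ 2 * q by apply: gen.
elim: s => [|i s IH].
  rewrite big_nil expr0n mul0r big1 // => j _.
  by rewrite big_nil normr0 expr0n.
under eq_bigr => j _ do rewrite big_cons.
by rewrite big_cons; apply: frobenius_add_le => //; apply: sumr_ge0.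
Qed.

End FrobeniusTriangle.

(** Branches stay unnormalized: their weights are their probabilities, and the squared weight makes
    the bound homogeneous. By induction branch [i] has purity at most [p_i^2] times that of the
    target, and the triangle inequality adds up the [p_i]. *)
Lemma locc_purity_le (R : realType) N (P : protocol R N) (psi tgt : qst R N) A :
  achieves P psi tgt -> weight tgt = 1 ->
  purity psi A <= weight psi ^+ 2 * purity tgt A.
Proof.
move=> + w1; elim: P psi A => [|k m ops next IH] psi A /=.
  by move=> [c ->]; rewrite purityZ weightZ w1 mulr1.
move=> [kr ach].
(* [red] traces out [A], so the measured qubit has to lie there; purity is symmetric under
   complement. *)
wlog kA : A / k \in A.
  move=> wl; have [|kA] := boolP (k \in A); first exact: wl.
  by rewrite -(purityC psi) -(purityC tgt); apply: wl; rewrite inE.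
have N4 : 0 < (4 ^ N)%:R :> complex R by rewrite ltr0n expn_gt0.
rewrite -(ler_pM2l N4) -red_sqnorm pair_big /=.
under eq_bigr => p _ do rewrite -(red_kraus _ _ _ kA kr).
rewrite mulrCA -(weight_kraus psi k kr).
apply: (frobenius_sum_le (G := fun i p => red (apply_local k (ops i) psi) A p.1 p.2))
  => i.
  exact: weight_ge0.
rewrite -(pair_big xpredT xpredT (fun w w' => `|red (apply_local k (ops i) psi) A w w'| ^+ 2)) /=.
by rewrite red_sqnorm mulrCA ler_pM2l //; apply: IH.
Qed.

(** * Padding a state with qubits in the zero state *)

Section Embedding.
Variables (R : realType) (n N : nat) (f : 'I_n -> 'I_N).
Hypothesis finj : injective f.

Definition ext_cfg (x : cfg n) : cfg N :=
  [ffun i => if [pick j | f j == i] is Some j then x j else false].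

Lemma ext_cfgE x j : ext_cfg x (f j) = x j.
Proof.
rewrite ffunE; case: pickP => [j' /eqP/finj-> //|/(_ j)].
by rewrite eqxx.
Qed.

Lemma ext_cfg_out x i : i \notin codom f -> ext_cfg x i = false.
Proof.
move=> iN; rewrite ffunE; case: pickP => // j /eqP ji.
by rewrite -ji codom_f in iN.
Qed.

Lemma embed_ext (phi : qst R n) x : embed_state f phi (ext_cfg x) = phi x.
Proof.
rewrite ffunE ifT; last by apply/forallP => i; apply/implyP => /ext_cfg_out ->.
by congr (phi _); apply/ffunP => j; rewrite ffunE ext_cfgE.
Qed.

Lemma glue_ext A x y :
  glue A (ext_cfg x) (ext_cfg y) = ext_cfg (glue (f @^-1: A) x y).
Proof.
apply/ffunP => i; have [/codomP[j ->]|iN] := boolP (i \in codom f).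
  by rewrite ffunE !ext_cfgE ffunE inE.
by rewrite ffunE !ext_cfg_out // if_same.
Qed.

Lemma sum_embed (V : nmodType) (F : cfg N -> V) :
  (forall x : cfg N, (exists2 i, i \notin codom f & x i) -> F x = 0) ->
  \sum_x F x = \sum_y F (ext_cfg y).
Proof.
move=> F0; rewrite (bigID (fun x : cfg N => [forall i, (i \notin codom f) ==> ~~ x i])) /=.
rewrite [X in _ + X]big1 ?addr0; last first.
  move=> x /forallPn[j]; rewrite negb_imply negbK => /andP[jN xj].
  by apply: F0; exists j.
rewrite (reindex_onto ext_cfg (fun x => [ffun j => x (f j)])) /=.
  apply: eq_bigl => y; apply/andP; split.
    by apply/forallP => i; apply/implyP => /ext_cfg_out ->.
  by apply/eqP/ffunP => j; rewrite ffunE ext_cfgE.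
move=> x /forallP xN; apply/ffunP => i.
have [/codomP[j ->]|iN] := boolP (i \in codom f); first by rewrite ext_cfgE ffunE.
by rewrite ext_cfg_out //; have /implyP/(_ iN)/negPf-> := xN i.
Qed.

Lemma embed_out (phi : qst R n) (x : cfg N) : (exists2 i, i \notin codom f & x i) ->
  embed_state f phi x = 0.
Proof.
move=> [i iN xi]; rewrite ffunE ifF //; apply/negP => /forallP/(_ i).
by rewrite iN xi.
Qed.

Lemma weight_embed (phi : qst R n) : weight (embed_state f phi) = weight phi.
Proof.
rewrite /weight sum_embed => [|x xo]; last by rewrite embed_out // mul0r.
by apply: eq_bigr => y _; rewrite embed_ext.
Qed.

(** The padding is a product factor, so a cut acts on [phi] through its preimage. *)
Lemma purity_embed (phi : qst R n) A :
  purity (embed_state f phi) A = purity phi (f @^-1: A).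
Proof.
rewrite /purity sum_embed => [|x xo]; last first.
  by rewrite big1 // => y _; rewrite (embed_out _ xo) !mul0r.
apply: eq_bigr => x _; rewrite sum_embed => [|y yo].
  by apply: eq_bigr => y _; rewrite !glue_ext !embed_ext.
by rewrite (embed_out _ yo) mul0r mulr0.
Qed.

End Embedding.

(** * Graph states *)

Section GraphState.
Variables (R : realType) (n : nat) (E : rel 'I_n).
Local Notation C := (complex R).
Implicit Types (x y d e : cfg n) (A : {set 'I_n}).

(** The exponent of the sign created by controlled-Z gates, one for each ordered pair in [E]. *)
Definition edge_parity x : bool :=
  \big[addb/false]_u \big[addb/false]_v (E u v && (x u && x v)).

Definition graph_state : qst R n :=
  [ffun x => sqrtC (2 ^+ n)^-1 * (-1) ^+ edge_parity x].

(** Coordinate [u] of the cut adjacency matrix over the field with two elements, applied to the part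
    of [e] outside [A]. *)
Definition cut_parity A e u : bool :=
  \big[addb/false]_v ((v \notin A) && (E u v (+) E v u) && e v).

Lemma graph_state_mul x y :
  graph_state x * (graph_state y)^* =
    (2 ^+ n)^-1 * (-1) ^+ (edge_parity x (+) edge_parity y).
Proof.
have c0 : 0 <= sqrtC (2 ^+ n : C)^-1.
  by rewrite sqrtC_ge0 invr_ge0 exprn_ge0.
rewrite !ffunE rmorphM /= (CrealP (ger0_real c0)) signr_addb.
have -> : ((-1 : C) ^+ edge_parity y)^* = (-1) ^+ edge_parity y.
  by rewrite rmorphXn rmorphN rmorph1.
by rewrite -[X in _ = X * _]sqrtCK; ring.
Qed.

Lemma weight_graph_state : weight graph_state = 1.
Proof.
rewrite /weight; under eq_bigr => x _ do rewrite graph_state_mul addbb mulr1.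
rewrite sumr_const card_ffun card_bool card_ord -[LHS]mulr_natr natrX.
by rewrite mulVf // expf_neq0 // pnatr_eq0.
Qed.

(** Pairs inside [A] or inside its complement cancel among the four terms; a pair across the cut
    leaves the product of the differences of [x] and [y] at its ends. *)
Lemma edge_parity_cut A x y :
  edge_parity x (+) edge_parity (glue A y x) (+)
    (edge_parity y (+) edge_parity (glue A x y)) =
  \big[addb/false]_u ((u \in A) && (x u (+) y u) &&
     (cut_parity A x u (+) cut_parity A y u)).
Proof.
transitivity (\big[addb/false]_u \big[addb/false]_v
   ((u \in A) && (v \notin A) && (E u v (+) E v u) &&
     ((x u (+) y u) && (x v (+) y v)))); last first.
  apply: eq_bigr => u _; rewrite -big_split /= big_distrr /=.
  apply: eq_bigr => v _.
  by case: (u \in A); case: (v \in A); case: (E u v); case: (E v u);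
    case: (x u); case: (y u); case: (x v); case: (y v).
(* Ordered pairs leaving [A] and pairs entering [A] are separated; transposing the latter gives the
   symmetrized adjacency. *)
transitivity (\big[addb/false]_u \big[addb/false]_v
   (((u \in A) && (v \notin A) && E u v && ((x u (+) y u) && (x v (+) y v))) (+)
    ((v \in A) && (u \notin A) && E u v && ((x u (+) y u) && (x v (+) y v))))).
  rewrite -!big_split /=; apply: eq_bigr => u _; rewrite -!big_split /=.
  apply: eq_bigr => v _; rewrite !ffunE.
  by case: (u \in A); case: (v \in A); case: (E u v);
    case: (x u); case: (y u); case: (x v); case: (y v).
under eq_bigr => u _ do rewrite big_split /=.
rewrite big_split /= [X in _ (+) X]exchange_big /= -big_split /=.
apply: eq_bigr => u _; rewrite -big_split /=; apply: eq_bigr => v _.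
by case: (u \in A); case: (v \in A); case: (E u v); case: (E v u);
  case: (x u); case: (y u); case: (x v); case: (y v).
Qed.

Definition xor_cfg x y : cfg n := [ffun i => x i (+) y i].

Lemma xor_cfgK y : involutive (xor_cfg ^~ y).
Proof. by move=> x; apply/ffunP => i; rewrite !ffunE -addbA addbb addbF. Qed.

Lemma cut_parity_xor A x y u :
  cut_parity A (xor_cfg x y) u = cut_parity A x u (+) cut_parity A y u.
Proof.
rewrite -big_split /=; apply: eq_bigr => v _; rewrite ffunE.
exact: andb_addr.
Qed.

(** Orthogonality of characters: the sum factors over the bits of [d], where a vertex of [A] with
    odd [cut_parity] contributes [1 - 1] and any other vertex contributes 2. *)
Lemma sum_sign_cut A e :
  \sum_(d : cfg n) (-1) ^+ (\big[addb/false]_u ((u \in A) && d u && cut_parity A e u)) =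
    (if [forall u in A, ~~ cut_parity A e u] then 2 ^+ n else 0) :> C.
Proof.
transitivity (\sum_(d : cfg n) \prod_u ((-1) ^+ ((u \in A) && d u && cut_parity A e u) : C)).
  apply: eq_bigr => d _.
  by apply: (big_morph (fun b : bool => (-1) ^+ b : C)) => // a b; rewrite signr_addb.
rewrite -(bigA_distr_bigA (fun u (b : bool) =>
   ((-1) ^+ ((u \in A) && b && cut_parity A e u) : C))) /=.
case: ifP => [/forall_inP all0|].
  rewrite -[in RHS](card_ord n) -prodr_const; apply: eq_bigr => u _.
  rewrite big_bool /= andbT andbF /=; case uA : (u \in A) => //=.
  by rewrite (negPf (all0 u uA)).
move=> /negbT; rewrite negb_forall_in => /exists_inP[u uA]; rewrite negbK => cu.
by rewrite (bigD1 u) //= big_bool /= uA cu /= expr1 addNr mul0r.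
Qed.

(* Expanding the purity over both configurations and substituting [d = x + y] on [A],
   [e = x + y] off [A] leaves the size of the kernel of the cut matrix. *)
Lemma purity_graph_state A :
  purity graph_state A =
    (2 ^+ n)^-1 * #|[set e | [forall u in A, ~~ cut_parity A e u]]%SET|%:R.
Proof.
pose s (b : bool) : C := (-1) ^+ b.
have two0 : (2 ^+ n : C) != 0 by rewrite expf_neq0 // pnatr_eq0.
transitivity ((2 ^+ n)^-1 ^+ 2 * \sum_(x : cfg n) \sum_(d : cfg n)
   s (\big[addb/false]_u ((u \in A) && d u && cut_parity A d u))).
  rewrite mulr_sumr; apply: eq_bigr => x _; rewrite mulr_sumr.
  rewrite [RHS](reindex_inj (inv_inj (@xor_cfgK x))) /=; apply: eq_bigr => y _.
  rewrite !graph_state_mul mulrACA -signr_addb edge_parity_cut expr2; congr (_ * s _).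
  apply: eq_bigr => u _; rewrite cut_parity_xor ffunE [x u (+) _]addbC.
  by rewrite [cut_parity A x u (+) _]addbC.
rewrite sumr_const card_ffun card_bool card_ord.
have glueE d e : \big[addb/false]_u ((u \in A) && glue A d e u && cut_parity A (glue A d e) u)
    = \big[addb/false]_u ((u \in A) && d u && cut_parity A e u).
  apply: eq_bigr => u _; rewrite ffunE; case uA : (u \in A) => //=; congr (_ && _).
  by apply: eq_bigr => v _; rewrite ffunE; case: (v \in A).
(* Making the parts of [d] on and off [A] independent variables costs one idle configuration, hence
   the factor [2 ^ n]. *)
have : \sum_(d : cfg n) \sum_(e : cfg n)
     s (\big[addb/false]_u ((u \in A) && d u && cut_parity A e u)) =
   (2 ^+ n) * \sum_(d : cfg n) s (\big[addb/false]_u ((u \in A) && d u && cut_parity A d u)).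
  under eq_bigr => d _ do under eq_bigr => e _ do rewrite -glueE.
  rewrite (sum_glue_swap A (fun d _ =>
     s (\big[addb/false]_u ((u \in A) && d u && cut_parity A d u)))).
  under eq_bigr => d _ do rewrite sumr_const.
  by rewrite sumrMnl card_ffun card_bool card_ord -[LHS]mulr_natl natrX.
rewrite exchange_big /=; under eq_bigr => e _ do rewrite sum_sign_cut.
rewrite -big_mkcond /= sumr_const => eqn.
set S := \sum_(d : cfg n) _ in eqn *.
have -> : S = #|[set e | [forall u in A, ~~ cut_parity A e u]]%SET|%:R.
  by apply: (mulfI two0); rewrite -eqn cardsE mulr_natr.
by rewrite -[X in _ * X = _]mulr_natl natrX expr2 -mulrA mulKf.
Qed.

(** Toggling a kernel element at the outer endpoints of a subset [S] of the matching loses nothing: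
    the cut parities at the inner endpoints recover [S], and then the element. *)
Lemma kernel_card_le A (I : {set 'I_n * 'I_n}) : cut_matching E A I ->
  (#|[set e | [forall u in A, ~~ cut_parity A e u]]%SET| * 2 ^ #|I| <= 2 ^ n)%N.
Proof.
move=> [IA IE]; set K := [set e | _]%SET.
pose toggle (e : cfg n) (S : {set 'I_n * 'I_n}) : cfg n :=
  xor_cfg e [ffun v => [exists p in S, p.2 == v]].
have tog e (S : {set 'I_n * 'I_n}) p : e \in K -> S \subset I -> p \in I ->
    cut_parity A (toggle e S) p.1 = (p \in S).
  move=> eK SI pI; rewrite cut_parity_xor.
  have /andP[p1A _] := IA p pI.
  move: eK; rewrite inE => /forall_inP/(_ _ p1A)/negPf-> /=.
  have key v : (v \notin A) && (E p.1 v (+) E v p.1) && [exists q in S, q.2 == v] =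
     (v == p.2) && (p \in S).
    apply/idP/idP.
      move=> /andP[/andP[vA Ev] /exists_inP[q qS /eqP qv]].
      have qI := fintype.subsetP SI q qS.
      by move: Ev; rewrite -qv (IE p q) // => /eqP pq; rewrite pq eqxx qS.
    move=> /andP[/eqP-> pS]; rewrite (IE p p) // eqxx.
    have /andP[_ ->] := IA p pI; apply/exists_inP; by exists p.
  rewrite /cut_parity; under eq_bigr => v _ do rewrite ffunE key.
  rewrite (bigD1 p.2) //= eqxx big1 ?addbF // => v /negPf->.
  by [].
rewrite -card_powerset -cardsX.
have <- : #|{: cfg n}| = (2 ^ n)%N by rewrite card_ffun card_bool card_ord.
have tinj : {in finset.setX K (powerset I) &, injective (fun z => toggle z.1 z.2)}.
  move=> [e S] [e' S']; rewrite !inE /= => /andP[eK SI] /andP[eK' SI'] eqt.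
  have SS : S = S'.
    apply/setP => p; have [pI|pI] := boolP (p \in I).
      by rewrite -(tog e S p) ?inE // eqt (tog e' S' p) ?inE.
    have out (Z : {set 'I_n * 'I_n}) : Z \subset I -> (p \in Z) = false.
      by move=> /fintype.subsetP ZI; apply: contraNF pI; apply: ZI.
    by rewrite !out.
  by rewrite SS in eqt *; congr pair; apply: (inv_inj (@xor_cfgK _)) eqt.
by rewrite -(card_in_imset tinj) max_card.
Qed.

Lemma purity_graph_state_le A (I : {set 'I_n * 'I_n}) k :
  cut_matching E A I -> (k <= #|I|)%N ->
  purity graph_state A <= ((2 ^+ k)^-1 : R)%:C%C.
Proof.
move=> /kernel_card_le; rewrite purity_graph_state; set K := #|_| => hK kI.
rewrite rmorphV /=; last by rewrite unitfE expf_neq0 // pnatr_eq0.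
rewrite rmorphXn rmorph_nat /=.
have p2 j : 0 < 2 ^+ j :> C by rewrite exprn_gt0 // ltr0n.
rewrite mulrC ler_pdivrMr ?p2 // mulrC ler_pdivlMr ?p2 //.
rewrite -!natrX -natrM ler_nat; apply: leq_trans hK.
by rewrite leq_mul2l leq_exp2l // kI orbT.
Qed.

End GraphState.

(** * Widths of states convertible into cluster states *)

Lemma cut_matching_enum (V : finType) (E : rel V) (A : {set 'I_#|V|}) I :
  cut_matching E (enum_rank @^-1: A) I ->
  exists2 J, cut_matching (fun i j => E (enum_val i) (enum_val j)) A J & #|J| = #|I|.
Proof.
move=> [IA IE]; pose h (p : V * V) := (enum_rank p.1, enum_rank p.2).
have hI : injective h.
  by move=> [a b] [c d] [/enum_rank_inj-> /enum_rank_inj->].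
exists (h @: I); last by rewrite card_imset.
split=> [p /imsetP[a aI ->]|p q /imsetP[a aI ->] /imsetP[b bI ->]] /=.
  by have := IA a aI; rewrite !inE.
by rewrite !enum_rankK (inj_eq hI) IE.
Qed.

Definition cluster_state (R : realType) m : qst R #|{: 'I_m * 'I_m}| :=
  graph_state R (fun i j => grid_edge (enum_val i) (enum_val j)).

Lemma cluster_normalized (R : realType) m : normalized (cluster_state R m).
Proof.
have := weight_graph_state R (fun i j : 'I_#|{: 'I_m * 'I_m}| =>
  grid_edge (enum_val i) (enum_val j)).
by rewrite weightE => -[].
Qed.

Lemma card_preim_inj (T T' : finType) (f : T -> T') (B : {set T'}) :
  injective f -> #|f @^-1: B| = #|[set f x | x in T] :&: B|.
Proof.
move=> fI; rewrite -(card_imset _ fI); apply: eq_card => y; rewrite inE.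
apply/imsetP/andP => [[x xB ->]|[/imsetP[x _ ->] xB]].
  by rewrite imset_f //; move: xB; rewrite inE.
by exists x => //; rewrite inE.
Qed.

Lemma cluster_purity_le (R : realType) k (A : {set 'I_#|{: 'I_(6 * k.+1) * 'I_(6 * k.+1)}|}) :
  ((6 * k.+1) * (6 * k.+1) <= 3 * #|A|)%N ->
  ((6 * k.+1) * (6 * k.+1) <= 3 * #|~: A|)%N ->
  purity (cluster_state R (6 * k.+1)) A <= ((2 ^+ k)^-1 : R)%:C%C.
Proof.
have rank_on (B : {set 'I_#|{: 'I_(6 * k.+1) * 'I_(6 * k.+1)}|}) :
    #|enum_rank @^-1: B| = #|B|.
  by apply: on_card_preimset; apply: onW_bij; apply: enum_rank_bij.
move=> cA cB.
have [||I HI kI] := @grid_balanced_matching k (enum_rank @^-1: A).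
- by rewrite rank_on.
- by rewrite -preimsetC rank_on.
have [J HJ cJ] := cut_matching_enum HI.
by apply: (purity_graph_state_le _ HJ); rewrite cJ.
Qed.

Section Width.
Variables (R : realType) (N k : nat) (psi : qst R N).
Hypothesis psi1 : normalized psi.
Hypothesis psi_locc : locc_ge psi (cluster_state R (6 * k.+1)).

(** Balance is required on the image of [f] only: the other qubits end in the zero state and do not
    affect the purity of the target. *)
Lemma tree_cut_purity (T : sctree N) : exists u v : 'I_(nv T),
  tadj u v /\ complex.Re (purity psi (side u v)) <= (2 ^+ k)^-1.
Proof.
have [nN [f [fI [P ach]]]] := psi_locc.
set m := (6 * k.+1)%N in f fI ach nN.
have cV : #|{: 'I_m * 'I_m}| = (m * m)%N by rewrite card_prod card_ord.
pose S := [set f x | x in 'I_#|{: 'I_m * 'I_m}|]%SET.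
have cS : #|S| = (m * m)%N by rewrite card_imset // card_ord cV.
have S3 : (3 < #|S|)%N by rewrite cS /m; nia.
have [u [v [uv h1 h2]]] := @balanced_edge N T S S3.
exists u, v; split => //.
have cl : purity (cluster_state R m) (f @^-1: side u v) <= ((2 ^+ k)^-1 : R)%:C%C.
  apply: cluster_purity_le; first by rewrite card_preim_inj // -cS.
  by rewrite -preimsetC card_preim_inj // -finset.setDE -cS.
have tgt1 : weight (embed_state f (cluster_state R m)) = 1.
  by rewrite weight_embed // weightE cluster_normalized.
have := locc_purity_le (side u v) ach tgt1.
rewrite weightE psi1 expr1n mul1r purity_embed // => /le_trans/(_ cl).
by rewrite lecE => /andP[].
Qed.

Lemma width_ge (g : {set 'I_N} -> R) :
  (forall A, complex.Re (purity psi A) <= (2 ^+ k)^-1 -> k%:R <= g A) ->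
  (k%:R%:E <= width g)%E.
Proof.
move=> gk; have [nN _] := psi_locc.
(* The grid has at least 36 vertices, so the convention for [N <= 1] does not apply. *)
rewrite /width ifF; last first.
  by apply/negbTE; rewrite -ltnNge; apply: leq_trans nN; rewrite card_prod card_ord; nia.
apply/ereal_infP => _ [T ->]; rewrite lee_fin.
have [u [v [uv pur]]] := tree_cut_purity T.
apply: le_trans (gk _ pur) _.
exact: (@le_bigmax_cond _ _ _ 0 (u, v) _ (fun e => g (side e.1 e.2))).
Qed.

Let log2_pow : - log2 ((2 ^+ k)^-1 : R) = k%:R.
Proof.
have ln2 : ln (2 : R) != 0 by rewrite gt_eqF // ln_gt0 // ltr1n.
by rewrite /log2 lnV ?posrE ?exprn_gt0 // lnXn // mulNr opprK -[ln 2 *+ k]mulr_natl mulfK.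
Qed.

Lemma locc_cluster_width_ge :
  (k%:R%:E <= E_wd psi)%E /\ (k%:R%:E <= chi_wd psi)%E.
Proof.
have q0 : 0 < (2 ^+ k)^-1 :> R by rewrite invr_gt0 exprn_gt0.
split; apply: width_ge => A pA; rewrite -log2_pow rho_gram.
  apply: gram_entropy_ge; rewrite // -rho_gram ?trace_rho ?trace_rho2 //.
  by rewrite weightE psi1.
apply: gram_log_rank_ge; rewrite // -rho_gram ?trace_rho ?trace_rho2 //.
by rewrite weightE psi1.
Qed.

End Width.

Theorem theorem5 (R : realType) (Psi : set (mqstate R)) :
  resource Psi ->
  (universal Psi ->
     sup_res (@E_wd R) Psi = +oo%E /\ sup_res (@chi_wd R) Psi = +oo%E) /\
  ((exists K : R, forall p, Psi p -> (E_wd (projT2 p) <= K%:E)%E) \/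
   (exists K : R, forall p, Psi p -> (chi_wd (projT2 p) <= K%:E)%E) ->
     ~ universal Psi).
Proof.
move=> [_ Psi1].
have large (K : R) : universal Psi -> exists2 p, Psi p &
    (K%:E < E_wd (projT2 p))%E /\ (K%:E < chi_wd (projT2 p))%E.
  (* A cluster state whose width bound [k] exceeds [K] is obtained from a single state of [Psi],
     which serves both widths. *)
  move=> univ; pose k := (Num.trunc `|K|).+1.
  have Kk : K < k%:R by apply: le_lt_trans (ler_norm K) (truncnS_gt _).
  have [p [Pp pl]] := univ _ _ (cluster_normalized R (6 * k.+1)).
  exists p => //; have [h1 h2] := locc_cluster_width_ge (Psi1 p Pp) pl.
  by split; [apply: lt_le_trans h1 | apply: lt_le_trans h2]; rewrite lte_fin.
have sup_infty (E : forall N, qst R N -> \bar R) :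
    (forall K : R, exists2 p, Psi p & (K%:E < E _ (projT2 p))%E) ->
    sup_res E Psi = +oo%E.
  move=> El; apply/eqyP => K _; have [p Pp /ltW Kp] := El K.
  by apply: (le_trans Kp); apply: ereal_sup_ubound; exists p.
split=> [univ|bounded univ].
  by split; apply: sup_infty => K; have [p Pp [h1 h2]] := large K univ; exists p.
case: bounded => -[K bK]; have [p Pp [h1 h2]] := large K univ.
  by have := bK p Pp; rewrite leNgt h1.
by have := bK p Pp; rewrite leNgt h2.
Qed.
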